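(* Let $T=(V,E)$ be a tree, let $V_c\subsetneq V$ with $|V_c|=3$, and let $g:V_c\to\{0,1\}$ be such that no two adjacent vertices of $V_c$ have the same value under $g$. Then any maximum contrast greyscale $f$ for the $\{0,1\}$-restricted maximum contrast problem on $T$ with initial colouring $g$ satisfies $|\{v\in V : f(v)=\frac12\}|\le 2$.
   Context: Graphs are finite, undirected and simple. A greyscale of a graph $G=(V,E)$ is a map $f:V\to[0,1]$ with $0,1\in \mathrm{Im}(f)$. For $e=\{u,v\}\in E$ put $\widehat f(e)=|f(u)-f(v)|$. The contrast vector $\mathcal C_f$ is the vector of all values $\widehat f(e)$, $e\in E$, listed in ascending order; contrast vectors are compared lexicographically. A greyscale $f$ is compatible with $g$ if $f(u)=g(u)$ for all $u\in V_c$. A maximum contrast greyscale for the $\{0,1\}$-restricted maximum contrast problem ($\{0,1\}$-RMACG) with data $(G,V_c,g)$ is a greyscale compatible with $g$ whose contrast vector is the lexicographic maximum among all greyscales of $G$ compatible with $g$. *)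

(* Defs.v *)
From mathcomp Require Import all_boot all_order all_algebra.
From mathcomp Require Import reals.

Set Implicit Arguments.
Unset Strict Implicit.
Unset Printing Implicit Defensive.

Import Order.TTheory GRing.Theory Num.Theory.
Local Open Scope ring_scope.

Definition simple_graph (V : finType) (e : rel V) : Prop :=
  symmetric e /\ irreflexive e.

Definition connected (V : finType) (e : rel V) : Prop :=
  (0 < #|V|)%N /\ forall u v : V, connect e u v.

(* For a symmetric relation every edge is a ucycle of size 2, so a genuine
   cycle of the graph is a ucycle of size at least 3. *)
Definition acyclic (V : finType) (e : rel V) : Prop :=
  forall c : seq V, ucycle e c -> (size c < 3)%N.

Definition is_tree (V : finType) (e : rel V) : Prop :=
  [/\ simple_graph e, connected e & acyclic e].

(* Each undirected edge {u, v} occurs exactly once, as the ordered pair whose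
   first component comes first in [enum V]. *)
Definition edges (V : finType) (e : rel V) : seq (V * V) :=
  [seq p <- enum {: V * V} |
    e p.1 p.2 && (enum_rank p.1 < enum_rank p.2)%N].

Definition is_greyscale (R : realType) (V : finType) (f : V -> R) : Prop :=
  [/\ forall v, 0 <= f v <= 1, exists v, f v = 0 & exists v, f v = 1].

(* Independent of the orientation chosen in [edges]. *)
Definition edge_contrast (R : realType) (V : finType) (f : V -> R)
    (p : V * V) : R :=
  `|f p.1 - f p.2|.

Definition contrast_vector (R : realType) (V : finType) (e : rel V)
    (f : V -> R) : seq R :=
  sort <=%R [seq edge_contrast f p | p <- edges e].

Definition contrast_le (R : realType) (V : finType) (e : rel V)
    (f1 f2 : V -> R) : bool :=
  ((contrast_vector e f1 : seqlexi R) <= contrast_vector e f2)%O.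

(* The values 0 and 1 of an initial colouring are the booleans, read in [R]. *)
Definition compatible (R : realType) (V : finType) (Vc : {set V})
    (g : {u : V | u \in Vc} -> bool) (f : V -> R) : Prop :=
  forall u : {u : V | u \in Vc}, f (val u) = (g u)%:R.

Definition max_contrast_greyscale (R : realType) (V : finType) (e : rel V)
    (Vc : {set V}) (g : {u : V | u \in Vc} -> bool) (f : V -> R) : Prop :=
  [/\ is_greyscale f, compatible g f &
      forall f' : V -> R, is_greyscale f' -> compatible g f' ->
        contrast_le e f' f].

(* Main.v *)
(** Let [H] be the set of vertices of value 1/2.  Relative to a proper
    2-colouring of the tree, one of the two types of vertices of [Vc] occurs at
    most once, say at [x].  Putting 1/2 on all the neighbours of [x], and 0 or 1
    elsewhere, gives a compatible greyscale with all contrasts at least 1/2;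
    hence a maximum contrast greyscale has all its contrasts at least 1/2 too,
    and therefore [H] is independent and separates [x] from the rest of [Vc].
    By uniqueness of paths a single vertex of [H] separates [x] from each of the
    other two vertices of [Vc], so some subset [S] of [H] with at most two
    elements still does.  Keeping 1/2 on [S] only and colouring the rest with 0
    and 1 increases every contrast, strictly so around each vertex outside [S]
    where [f] is 1/2; hence [H] is contained in [S]. *)
Require Import Defs.
From mathcomp Require Import all_boot all_order all_algebra.
From mathcomp Require Import reals.
From mathcomp Require Import lra.

Set Implicit Arguments.
Unset Strict Implicit.
Unset Printing Implicit Defensive.

Import Order.TTheory GRing.Theory Num.Theory.
Local Open Scope ring_scope.

(** * Trees: unique simple paths, bipartiteness, cut vertices *)

(** If [a] and [b] differed, shortening the path between them and closing it up through [x] would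
    give a cycle of size at least 3. *)
Lemma acyclic_nbr_inj (V : finType) (e : rel V) (x a b : V) (p : seq V) :
    symmetric e -> acyclic e -> e x a -> e x b -> path e a p -> last a p = b ->
  x \notin a :: p -> a = b.
Proof.
move=> esym eac exa exb pp; case/shortenP: pp => q qp uq sq lq xap.
have /eac : ucycle e (x :: a :: q).
  rewrite /ucycle /= exa rcons_path qp lq esym exb /=.
  rewrite -[_ && uniq q]/(uniq (a :: q)) uq andbT.
  apply: contra xap; rewrite !inE => /orP[-> // | /sq ->]; exact: orbT.
by case: q lq {qp uq sq}.
Qed.

Lemma acyclic_path_uniq (V : finType) (e : rel V) (x : V) (p q : seq V) :
    symmetric e -> acyclic e -> path e x p -> path e x q ->
    uniq (x :: p) -> uniq (x :: q) -> last x p = last x q -> p = q.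
Proof.
move=> esym eac; elim: p x q => [|a p IHp] x [|b q] //=.
- by move=> _ _ _ /andP[/negP xq _] xE; case: xq; rewrite xE mem_last.
- by move=> _ _ /andP[/negP xq _] _ xE; case: xq; rewrite -xE mem_last.
move=> /andP[exa pp] /andP[exb pq] /andP[xp up] /andP[xq uq] lE.
have ab : a = b.
  (* Follow [p] to the common endpoint, then [q] backwards to [b]. *)
  have pab : path e a (p ++ rev (belast b q)).
    rewrite cat_path pp lE rev_path /=.
    by rewrite (eq_path (e' := e)) // => u v; rewrite esym.
  apply: (acyclic_nbr_inj esym eac exa exb pab).
    by rewrite last_cat; case: q {IHp pq pab} xq uq lE => //= d q _ _ ->;
       rewrite rev_cons last_rcons.
  rewrite -cat_cons mem_cat negb_or xp mem_rev.
  by apply: contra xq; apply: mem_belast.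
by subst b; congr (_ :: _); apply: (IHp a).
Qed.

Lemma tree_simple_path (V : finType) (e : rel V) (x y : V) :
  is_tree e -> exists p, [/\ path e x p, uniq (x :: p) & last x p = y].
Proof.
move=> [_ [_ /(_ x y)/connectP[p pp ->]] _].
by case/shortenP: pp => q; exists q.
Qed.

(** The colour of [v] is the parity of the length of the simple path from a root [r] to [v]. *)
Lemma tree_bipartite (V : finType) (e : rel V) :
  is_tree e -> exists c : V -> bool, forall u v, e u v -> c u != c v.
Proof.
move=> Te; have [[esym eirr] [V0 econ] eac] := Te.
have [r _] := card_gt0P V0.
have [P PP] := fin_all_exists (fun v => tree_simple_path r v Te).
have PE p : path e r p -> uniq (r :: p) -> p = P (last r p).
  move=> pp up; have [qq uq lq] := PP (last r p).
  exact: (acyclic_path_uniq esym eac pp qq up uq).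
have step u v : e u v -> v \notin r :: P u ->
    odd (size (P u)) != odd (size (P v)).
  move=> euv vP; have [pp up lp] := PP u.
  have -> : P v = rcons (P u) v.
    rewrite [RHS]PE ?last_rcons //; first by rewrite rcons_path pp lp.
    by rewrite -rcons_cons rcons_uniq vP.
  by rewrite size_rcons /=; case: odd.
exists (fun v => odd (size (P v))) => u v euv.
(* If [v] lies on the path to [u], that path is [P v] followed by [u]; hence [u] is off the path to
   [v], and [step] applies with the roles exchanged. *)
have [vP|vP] := boolP (v \in r :: P u); last exact: step.
rewrite eq_sym; apply: step; first by rewrite esym.
have [pp up lp] := PP u; have [qq uq lq] := PP v.
case/splitPl: vP pp up lp => p1 p2 lv.
rewrite -cat_cons cat_path cat_uniq last_cat lv.
move=> /andP[pp1 pp2] /and3P[up1 dis up2] lu.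
have <- : p1 = P v by rewrite -lv; exact: PE.
have p2E : p2 = [:: u].
  apply: (acyclic_path_uniq esym eac pp2) => //=; first by rewrite esym euv.
  - rewrite up2 andbT; apply: contra dis => vp2; apply/hasP; exists v => //=.
    by rewrite -lv mem_last.
  - rewrite inE andbT; apply/eqP => vu; by rewrite vu eirr in euv.
by move: dis; rewrite p2E /= orbF.
Qed.

(** The simple path from [x] to [y] meets [H] in some [s], and every walk from [x] to [y] shortens
    to that same path. *)
Lemma tree_cut_vertex (V : finType) (e : rel V) (H : {set V}) (x y : V) :
    is_tree e ->
    (forall p, path e x p -> last x p = y -> has (mem H) (x :: p)) ->
  exists2 s, s \in H & forall p, path e x p -> last x p = y -> s \in x :: p.
Proof.
move=> Te hitH; have [[esym _] _ eac] := Te.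
have [p [pp up lp]] := tree_simple_path x y Te.
have /hasP[s sp sH] := hitH p pp lp; exists s => // q.
case/shortenP=> r pr ur sr lr.
have rE : p = r by apply: (acyclic_path_uniq esym eac pp pr up ur); rewrite lp.
by move: sp; rewrite rE !inE => /orP[-> // | /sr ->]; rewrite orbT.
Qed.

Lemma tree_neighbour (V : finType) (e : rel V) (u v : V) :
  is_tree e -> u != v -> exists w, e u w.
Proof.
move=> [_ [_ /(_ u v)/connectP[p pp vE]] _] uv.
case: p pp vE => [_ vE|w p /= /andP[euw _] _]; last by exists w.
by rewrite vE /= eqxx in uv.
Qed.

(** * Lexicographic comparison of sorted lists *)

(** Counting at the head of [s2] shows that the head of [s1] is no larger; the lexicographic order
    gives the reverse inequality. So the heads agree, and induction applies to the tails. *)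
Lemma sorted_lexi_count_eq (R : realType) (s1 s2 : seq R) :
    sorted <=%R s1 -> sorted <=%R s2 -> size s1 = size s2 ->
    ((s2 : seqlexi R) <= s1)%O ->
    (forall t, count (<= t) s2 <= count (<= t) s1)%N ->
  s1 = s2.
Proof.
elim: s1 s2 => [|a1 s1 IHs] [|a2 s2] //= ss1 ss2 [sz12].
rewrite Order.SeqLexiOrder.lexi_cons => /andP[a21 /implyP lex] cnt.
have a12 : a1 <= a2.
  have : has (<= a2) (a1 :: s1).
    by rewrite has_count (leq_trans _ (cnt a2)) //= lexx.
  rewrite /= => /orP[// | /hasP[b bs1 /= ba2]].
  have /allP/(_ b bs1)/= := order_path_min le_trans ss1.
  by move/le_trans; apply.
have aE : a1 = a2 by apply/eqP; rewrite eq_le a12.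
subst a2; congr (_ :: _); apply: IHs => //.
- exact: path_sorted ss1.
- exact: path_sorted ss2.
- exact: lex.
by move=> t; have := cnt t; rewrite leq_add2l.
Qed.

(** Pointwise domination orders the counts below every threshold, so a failure would make the sorted
    lists equal. Their sums would then agree, against the strict increase at [i]. *)
Lemma sort_map_lexi_lt (R : realType) (I : eqType) (s : seq I) (F G : I -> R)
    (i : I) :
    {in s, forall j, F j <= G j} -> i \in s -> F i < G i ->
  ~~ ((sort <=%R (map G s) : seqlexi R) <= sort <=%R (map F s))%O.
Proof.
move=> FG si FGi; apply/negP => lex.
have sE : sort <=%R (map F s) = sort <=%R (map G s).
  apply: sorted_lexi_count_eq => //; try exact: sort_le_sorted.
    by rewrite !size_sort !size_map.
  move=> t; rewrite !(permP (permEl (perm_sort _ _))) !count_map.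
  rewrite -!sum1_count [leqLHS]big_mkcond [leqRHS]big_mkcond /= !big_seq.
  apply: leq_sum => j js /=; case: ifP => // Gt.
  by rewrite (le_trans (FG j js) Gt).
have sumE : \sum_(j <- s) F j = \sum_(j <- s) G j.
  rewrite -(big_map F predT id) -(big_map G predT id).
  by rewrite -(perm_big _ (permEl (perm_sort <=%R _))) sE
             (perm_big _ (permEl (perm_sort <=%R _))).
have : \sum_(j <- s | j \in s) (G j - F j) == 0.
  by rewrite -big_seq sumrB sumE subrr.
rewrite psumr_eq0 => [/allP/(_ i si)|j js]; last by rewrite subr_ge0 FG.
by rewrite si subr_eq0 => /eqP GF; rewrite GF ltxx in FGi.
Qed.

(** Comparing the heads, which are the minima, suffices; equal sizes exclude an empty [s1] beside a
    nonempty [s2]. *)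
Lemma sort_lexi_lower_bound (R : realType) (a : R) (s1 s2 : seq R) :
    ((sort <=%R s1 : seqlexi R) <= sort <=%R s2)%O -> size s1 = size s2 ->
  {in s1, forall b, a <= b} -> {in s2, forall b, a <= b}.
Proof.
move=> lex sz; rewrite -(size_sort <=%R s1) -(size_sort <=%R s2) in sz.
move=> as1 b; rewrite -(mem_sort <=%R).
have as1' d : d \in sort <=%R s1 -> a <= d by rewrite mem_sort; exact: as1.
move: (sort_le_sorted s2) lex sz as1'.
case: (sort _ s2) => [|a2 r2] //; case: (sort _ s1) => [|a1 r1] // srt.
rewrite Order.SeqLexiOrder.lexi_cons => /andP[a12 _] _.
move=> /(_ a1 (mem_head _ _)) aa1 br2.
apply: le_trans aa1 (le_trans a12 _).
move: br2; rewrite inE => /predU1P[-> // | br2].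
by have /allP/(_ b br2) := order_path_min le_trans srt.
Qed.

(** * Contrasts of greyscales and colourings with values 0, 1/2 and 1 *)

Section Contrast.

Variables (R : realType) (V : finType) (e : rel V).
Hypothesis Te : is_tree e.

Lemma mem_edges_sym (u v : V) :
  e u v -> (u, v) \in edges e \/ (v, u) \in edges e.
Proof.
have [[esym eirr] _ _] := Te => euv.
rewrite !mem_filter /= (esym v u) euv -enumT !mem_enum !andbT.
case: ltngtP => [||/ord_inj/enum_rank_inj uv]; [by left | by right |].
by rewrite uv eirr in euv.
Qed.

Lemma contrast_ltNle (f f' : V -> R) (u v : V) :
    (forall a b, e a b -> `|f a - f b| <= `|f' a - f' b|) ->
    e u v -> `|f u - f v| < `|f' u - f' v| ->
  ~~ contrast_le e f' f.
Proof.
move=> ff' /mem_edges_sym euv lt_uv.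
have le_e : {in edges e, forall p, edge_contrast f p <= edge_contrast f' p}.
  by move=> p; rewrite mem_filter => /andP[/andP[ep _] _]; exact: ff'.
case: euv => pe; apply: (sort_map_lexi_lt le_e pe) => //.
by rewrite /edge_contrast /= distrC [ltRHS]distrC.
Qed.

Lemma contrast_le_lower_bound (a : R) (f f' : V -> R) :
    contrast_le e f' f -> (forall u v, e u v -> a <= `|f' u - f' v|) ->
  forall u v, e u v -> a <= `|f u - f v|.
Proof.
move=> ff' af' u v euv.
have af : {in map (edge_contrast f) (edges e), forall b, a <= b}.
  apply: (sort_lexi_lower_bound ff'); first by rewrite !size_map.
  move=> b /mapP[p pe ->]; apply: af'.
  by move: pe; rewrite mem_filter => /andP[/andP[]].
case: (mem_edges_sym euv) => pe; last rewrite distrC.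
  exact: af (map_f _ pe).
exact: af (map_f _ pe).
Qed.

Definition half_coloring (S : {set V}) (b : V -> bool) (v : V) : R :=
  if v \in S then 1 / 2 else (b v)%:R.

Definition proper_off (S : {set V}) (b : V -> bool) : Prop :=
  forall u v, e u v -> u \notin S -> v \notin S -> b u != b v.

Lemma half_coloring_contrast1 (S : {set V}) (b : V -> bool) (u v : V) :
    proper_off S b -> e u v -> u \notin S -> v \notin S ->
  `|half_coloring S b u - half_coloring S b v| = 1.
Proof.
move=> bS euv uS vS; have := bS u v euv uS vS.
rewrite /half_coloring (negPf uS) (negPf vS).
by case: (b u) (b v) => [] [] //= _; rewrite ?subr0 ?sub0r ?normrN normr1.
Qed.

Lemma half_coloring_contrast_ge (S : {set V}) (b : V -> bool) (u v : V) :
    (forall u v, u \in S -> v \in S -> ~~ e u v) -> proper_off S b -> e u v ->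
  1 / 2 <= `|half_coloring S b u - half_coloring S b v|.
Proof.
move=> indS bS euv.
have half_bool (x : bool) : `|(1 / 2 : R) - x%:R| = 1 / 2.
  by case: x => /=; [rewrite ler0_norm | rewrite ger0_norm]; lra.
have [uS|uS] := boolP (u \in S); have [vS|vS] := boolP (v \in S).
- by have := indS u v uS vS; rewrite euv.
- by rewrite /half_coloring uS (negPf vS) half_bool.
- by rewrite distrC /half_coloring vS (negPf uS) half_bool.
- by rewrite half_coloring_contrast1 //; lra.
Qed.

Lemma half_coloring_greyscale (S : {set V}) (b : V -> bool) (u v : V) :
    u \notin S -> v \notin S -> b u != b v -> is_greyscale (half_coloring S b).
Proof.
move=> uS vS buv; split=> [w||].
- rewrite /half_coloring; case: ifP => _; [|case: (b w) => /=];
    by apply/andP; split; lra.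
- exists (if b u then v else u); move: buv; rewrite /half_coloring.
  case bu: (b u) => buv; rewrite ?(negPf uS) ?(negPf vS) ?bu //.
  by case: (b v) buv.
- exists (if b u then u else v); move: buv; rewrite /half_coloring.
  case bu: (b u) => buv; rewrite ?(negPf uS) ?(negPf vS) ?bu //.
  by case: (b v) buv.
Qed.

Lemma contrast_half_le (f : V -> R) (u v : V) :
  is_greyscale f -> f u = 1 / 2 \/ f v = 1 / 2 -> `|f u - f v| <= 1 / 2.
Proof.
move=> [f01 _ _] fuv; rewrite ler_norml.
have /andP[u0 u1] := f01 u; have /andP[v0 v1] := f01 v.
by case: fuv => fE; rewrite fE in u0 u1 v0 v1 *; apply/andP; split; lra.
Qed.

Variables (Vc : {set V}) (g : V -> bool).

(** This is [compatible] for a [g] extended to all of [V], which avoids the subtype of [Vc]. *)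
Definition agrees (f : V -> R) : Prop := {in Vc, forall v, f v = (g v)%:R}.

Lemma half_coloring_agrees (S : {set V}) (b : V -> bool) :
    {in Vc, forall v, v \notin S /\ b v = g v} -> agrees (half_coloring S b).
Proof.
by move=> Sb v /Sb[vS bg]; rewrite /half_coloring (negPf vS) bg.
Qed.

Variable c : V -> bool.
Hypothesis proper_c : forall u v, e u v -> c u != c v.

(** The type [c v (+) g v] records whether [g] follows the bipartition [c] at [v] or its complement.
    The name fits once [b0] is chosen so that at most one vertex has the other type. *)
Definition minority (b0 : bool) := [set v in Vc | c v (+) g v != b0].

Lemma in_minority b0 v : v \in Vc -> (v \in minority b0) = (c v (+) g v != b0).
Proof. by move=> vV; rewrite inE vV. Qed.

Lemma exists_contrast_ge (b0 : bool) :
    (1 < #|Vc|)%N -> (#|minority b0| <= 1)%N ->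
    {in Vc &, forall u v, e u v -> g u != g v} ->
  exists f', [/\ is_greyscale f', agrees f' &
                 forall u v, e u v -> 1 / 2 <= `|f' u - f' v|].
Proof.
move=> Vc1 D1 proper_g; set D := minority b0.
have [[esym eirr] _ _] := Te.
have DV v : v \in D -> v \in Vc by rewrite inE => /andP[].
have Deq : {in D &, forall x y, x = y} by move=> x y xD /(card_le1_eqP D1 x)->.
pose S := [set v | [exists x in D, e x v]].
have SP v : reflect (exists2 x, x \in D & e x v) (v \in S).
  by rewrite inE; apply: exists_inP.
(* Adding the type of a constrained vertex to its colour [c v] recovers [g v]; the type is [~~ b0]
   on [D] and [b0] on the rest of [Vc]. *)
pose b v := c v (+) (if v \in D then ~~ b0 else b0).
have bg : {in Vc, b =1 g}.
  move=> v vV; rewrite /b in_minority //.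
  by case: (c v) (g v) (b0) => [] [] [].
(* Along an edge inside [Vc] both [c] and [g] switch, so the type is preserved: a constrained
   neighbour of [x] would be a second element of [D]. *)
have VS v : v \in Vc -> v \notin S.
  move=> vV; apply/SP => -[x xD exv]; have xV := DV x xD.
  have vD : v \in D.
    move: xD (proper_c exv) (proper_g x v xV vV exv).
    rewrite /D !in_minority //.
    by case: (c v) (g v) (c x) (g x) => [] [] [] [].
  by rewrite (Deq _ _ xD vD) eirr in exv.
have bS : proper_off S b.
  move=> u v euv uS vS.
  have uD : u \notin D by apply: contra vS => uD; apply/SP; exists u.
  have vD : v \notin D.
    by apply: contra uS => vD; apply/SP; exists v => //; rewrite esym.
  rewrite /b (negPf uD) (negPf vD); have := proper_c euv.
  by case: (c u) (c v) (b0) => [] [] [].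
have indS u v : u \in S -> v \in S -> ~~ e u v.
  move=> /SP[x xD exu] /SP[y yD]; rewrite -(Deq x y xD yD) => exv.
  apply/negP => euv.
  by have := proper_c exu; have := proper_c exv; have := proper_c euv;
     case: (c u) (c v) (c x) => [] [] [].
exists (half_coloring S b); split.
(* To attain both 0 and 1, take a neighbour [w] of [y]. If [w] is outside [S], then [b] separates
   [y] from [w]. Otherwise [w] is also adjacent to some [x] in [D]; then [c x = c y] while the types
   differ, so [b] separates [x] from [y]. *)
- have [y yV yD] : exists2 y, y \in Vc & y \notin D.
    apply/subsetPn/negP => /subset_leq_card.
    by rewrite leqNgt (leq_ltn_trans D1).
  have [v yv] : exists v, y != v.
    have [x [z [_ _ xz]]] := card_gt1P Vc1.
    by have [yx|] := eqVneq y x; [exists z; rewrite yx | exists x].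
  have [w eyw] := tree_neighbour Te yv; have yS := VS y yV.
  have [/SP[x xD exw]|wS] := boolP (w \in S); last first.
    exact: half_coloring_greyscale yS wS (bS _ _ eyw yS wS).
  have xV := DV x xD; apply: (half_coloring_greyscale yS (VS x xV)).
  rewrite !bg //; move: xD yD (proper_c exw) (proper_c eyw).
  rewrite /D !in_minority //.
  by case: (c y) (g y) (c x) (g x) (c w) (b0) => [] [] [] [] [] [].
- by apply: half_coloring_agrees => v vV; split; [exact: VS | exact: bg].
- by move=> u v; apply: half_coloring_contrast_ge.
Qed.

(** * The vertices of value 1/2 in a maximum contrast greyscale *)

Variable f : V -> R.
Hypothesis greyf : is_greyscale f.
Hypothesis agreef : agrees f.
Hypothesis maxf : forall f', is_greyscale f' -> agrees f' -> contrast_le e f' f.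
Hypothesis contrast_ge : forall u v, e u v -> 1 / 2 <= `|f u - f v|.

Definition half_set := [set v : V | f v == 1 / 2].

Lemma half_setP v : reflect (f v = 1 / 2) (v \in half_set).
Proof. by rewrite inE; apply: eqP. Qed.

Lemma half_set_independent u v : u \in half_set -> v \in half_set -> ~~ e u v.
Proof.
move=> /half_setP fu /half_setP fv; apply/negP => /contrast_ge.
by rewrite fu fv subrr normr0; lra.
Qed.

Lemma half_set_constrained v : v \in Vc -> v \notin half_set.
Proof.
move=> /agreef fv; apply/negP => /half_setP.
by rewrite fv; case: (g v) => /=; lra.
Qed.

(** A vertex [h] of [half_set] outside [S] would make [half_coloring S b] strictly better than [f]:
    at an edge leaving [h] the contrast rises from at most 1/2 to 1. *)
Lemma half_set_sub (S : {set V}) (b : V -> bool) :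
    (1 < #|Vc|)%N -> S \subset half_set -> proper_off S b -> {in Vc, b =1 g} ->
  half_set \subset S.
Proof.
move=> Vc1 /subsetP SH bS bg; apply/subsetP => h hH; apply/negPn/negP => hS.
have [v vh] : exists v, h != v.
  have [x [y [_ _ xy]]] := card_gt1P Vc1.
  by have [hx|] := eqVneq h x; [exists y; rewrite hx | exists x].
have [w ehw] := tree_neighbour Te vh.
have wH : w \notin half_set.
  by apply/negP => wH; have := half_set_independent hH wH; rewrite ehw.
have wS : w \notin S by apply: contra wH; exact: SH.
have c1 := half_coloring_contrast1 bS ehw hS wS.
have indS u z : u \in S -> z \in S -> ~~ e u z.
  by move=> /SH uH /SH zH; exact: half_set_independent.
have greyS := half_coloring_greyscale hS wS (bS _ _ ehw hS wS).
have agreeS : agrees (half_coloring S b).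
  apply: half_coloring_agrees => u uV; split; last exact: bg.
  by apply: contra (half_set_constrained uV); exact: SH.
have := maxf greyS agreeS; apply/negP; apply: contrast_ltNle ehw _.
  move=> u z euz.
  (* An edge meeting [S] has contrast at most 1/2 under [f] and at least 1/2 now; any other edge now
     has contrast 1, the largest possible. *)
  have [/orP uzS|] := boolP ((u \in S) || (z \in S)).
    apply: le_trans (half_coloring_contrast_ge indS bS euz).
    apply: contrast_half_le => //.
    by case: uzS => /SH/half_setP; [left | right].
  rewrite negb_or => /andP[uS zS]; rewrite half_coloring_contrast1 //.
  have [f01 _ _] := greyf; have /andP[u0 u1] := f01 u.
  by have /andP[z0 z1] := f01 z; rewrite ler_norml; apply/andP; split; lra.
rewrite c1; apply: (@le_lt_trans _ _ (1 / 2)); last lra.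
by apply: contrast_half_le => //; left; apply/half_setP.
Qed.

(** Two values of [0,1] strictly on the same side of 1/2 differ by less than 1/2. *)
Lemma gt_half_proper u v :
    e u v -> u \notin half_set -> v \notin half_set ->
  (1 / 2 < f u) != (1 / 2 < f v).
Proof.
move=> /contrast_ge fuv /half_setP/eqP fu /half_setP/eqP fv.
have [f01 _ _] := greyf; have /andP[u0 u1] := f01 u; have /andP[v0 v1] := f01 v.
apply: contraTN fuv; rewrite -ltNge ltr_norml.
move: fu fv; case: (ltgtP (f u)) => //= fu _; case: (ltgtP (f v)) => //= fv _ _;
  by apply/andP; split; lra.
Qed.

(** Along a walk avoiding [half_set], both [c] and the side of 1/2 switch at each edge, so their sum
    is constant. On [Vc] this sum is the type, which differs at [x] and [y]. *)
Lemma half_set_hit b0 x y p :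
    x \in minority b0 -> y \in Vc :\: minority b0 -> path e x p ->
  last x p = y -> has (mem half_set) (x :: p).
Proof.
move=> xD /setDP[yV yD] pp lp; apply: contraT => noH.
have const : c x (+) (1 / 2 < f x) = c (last x p) (+) (1 / 2 < f (last x p)).
  elim: p x pp noH {lp xD} => //= w p IHp x /andP[exw pp].
  rewrite !negb_or => /and3P[xH wH pH].
  rewrite -IHp //=; last by rewrite negb_or wH.
  have := gt_half_proper exw xH wH; have := proper_c exw.
  by case: (c x) (c w) (1 / 2 < f x) (1 / 2 < f w) => [] [] [] [].
have gE v : v \in Vc -> (1 / 2 < f v) = g v.
  by move=> /agreef ->; case: (g v) => /=; [|apply/negbTE; rewrite -leNgt]; lra.
have xV : x \in Vc by move: xD; rewrite inE => /andP[].
move: const xD yD; rewrite lp !gE // !in_minority // => ->.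
by case: (_ != _).
Qed.

Lemma card_half_set b0 :
    (#|Vc| <= 3)%N -> (1 < #|Vc|)%N -> (#|minority b0| <= 1)%N ->
  (#|half_set| <= 2)%N.
Proof.
move=> Vc3 Vc1 D1; set D := minority b0 in D1 *.
have [[esym _] _ _] := Te.
(* The membership conditions are premises, so that a separator can be chosen for every pair;
   irrelevant pairs get an arbitrary vertex. *)
pose isep (q : V * V) s := q.1 \in D -> q.2 \in Vc :\: D ->
  s \in half_set /\
  forall p, path e q.1 p -> last q.1 p = q.2 -> s \in q.1 :: p.
have [sep sepP] : exists sep, forall q, isep q (sep q).
  apply: fin_all_exists => -[x y]; rewrite /isep /=.
  have [xD|] := boolP (x \in D); last by exists x.
  have [yD|] := boolP (y \in Vc :\: D); last by exists x.
  have [s sH sP] := tree_cut_vertex Te (fun p => half_set_hit xD yD).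
  by exists s.
pose S := [set sep q | q in setX D (Vc :\: D)].
(* There is one separator per pair: none if [D] is empty, and at most 1 * (3 - 1) if [D] is a
   singleton. *)
have S2 : (#|S| <= 2)%N.
  rewrite (leq_trans (leq_imset_card _ _)) // cardsX cardsD.
  have -> : Vc :&: D = D by apply/setIidPr/subsetP => v; rewrite inE => /andP[].
  by move: D1; case: #|D| => [|[|d]] // _; rewrite mul1n leq_subLR.
have SH : S \subset half_set.
  apply/subsetP => s /imsetP[[x y] /setXP[xD yD] ->].
  by have [] := sepP (x, y) xD yD.
pose eS := [rel u v | [&& e u v, u \notin S & v \notin S]].
(* The vertices reachable from [D] without meeting [S]; the colouring [b] uses type [~~ b0] there
   and [b0] elsewhere. *)
pose near v := [exists x in D, connect eS x v].
apply: leq_trans S2; apply: subset_leq_card.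
pose b v := c v (+) (if near v then ~~ b0 else b0).
apply: (half_set_sub (b := b)) => //.
  move=> u v euv uS vS.
  have nearE : near u = near v.
    have conn x : connect eS x u = connect eS x v.
      by apply/idP/idP => /connect_trans; apply; apply: connect1;
         rewrite /= ?euv 1?esym ?euv uS vS.
    by rewrite /near; apply: eq_existsb => x; rewrite conn.
  rewrite /b nearE; have := proper_c euv.
  by case: (near v) (c u) (c v) (b0) => [] [] [] [].
(* A path avoiding [S] from [x] in [D] to [v] in [Vc] outside [D] would contain [sep (x, v)]. This
   vertex is not [x], whose value is 0 or 1, so it is a later vertex lying in [S]. *)
move=> v vV; rewrite /b; have -> : near v = (v \in D).
  apply/exists_inP/idP => [[x xD /connectP[p pp vE]]|vD]; last first.
    by exists v; rewrite ?connect0.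
  apply: contraT => vD.
  have vVD : v \in Vc :\: D by rewrite inE vD.
  have [sH /(_ p)] := sepP (x, v) xD vVD.
  have pe : path e x p by apply: sub_path pp => y z /and3P[].
  move=> /(_ pe (Logic.eq_sym vE)); rewrite inE => /predU1P[sx|].
    by move: sH; rewrite sx (negPf (half_set_constrained _)) //;
       move: xD; rewrite inE => /andP[].
  have sS : sep (x, v) \in S by apply: imset_f; rewrite in_setX xD vVD.
  have pS : all [predC S] p.
    elim: p x pp {vE xD pe sH sS} => //= w p IHp x.
    by move=> /andP[/and3P[_ _ ->] /IHp].
  by move=> /(allP pS); rewrite inE /= sS.
rewrite in_minority //.
by case: (c v) (g v) (b0) => [] [] [].
Qed.

End Contrast.

Theorem theorem5p8 (R : realType) (V : finType) (e : rel V)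
    (Vc : {set V}) (g : {u : V | u \in Vc} -> bool) (f : V -> R) :
  is_tree e ->
  Vc \proper [set: V] ->
  #|Vc| = 3%N ->
  (forall u v : {u : V | u \in Vc}, e (val u) (val v) -> g u != g v) ->
  max_contrast_greyscale e g f ->
  (#|[set v : V | f v == 1 / 2]| <= 2)%N.
Proof.
move=> Te _ Vc3 proper_g [greyf compf maxf].
pose h v := if insub v is Some u then g u else false.
have hE (u : {u : V | u \in Vc}) : h (val u) = g u by rewrite /h valK.
have agrees_compatible (f' : V -> R) : agrees Vc h f' <-> compatible g f'.
  split=> [agr u|cmp v vV]; first by rewrite (agr _ (valP u)) hE.
  by rewrite -[v]/(val (exist _ v vV)) cmp hE.
have [c proper_c] := tree_bipartite Te.
(* The two types partition the three vertices of [Vc], so one of them occurs at most once. *)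
have [b0 D1] : exists b0, (#|minority Vc h c b0| <= 1)%N.
  have : (#|minority Vc h c true| + #|minority Vc h c false| = 3)%N.
    rewrite -Vc3 -(cardsID [set v | c v (+) h v] Vc) addnC.
    congr (_ + _)%N; apply: eq_card => v; rewrite !inE; last rewrite andbC;
      by case: (_ (+) _) (v \in Vc) => [] [].
  case: (leqP #|minority Vc h c true| 1) => [|D2 D3]; first by exists true.
  exists false.
  by rewrite -(leq_add2l 2) (leq_trans _ (eq_leq D3)) // leq_add2r.
have Vc1 : (1 < #|Vc|)%N by rewrite Vc3.
have proper_h : {in Vc &, forall u v, e u v -> h u != h v}.
  move=> u v uV vV euv.
  rewrite -[u]/(val (exist _ u uV)) -[v]/(val (exist _ v vV)).
  by rewrite !hE; apply: proper_g.
have [f' [grey' agr' ge']] := exists_contrast_ge R Te proper_c Vc1 D1 proper_h.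
have maxh f1 : is_greyscale f1 -> agrees Vc h f1 -> contrast_le e f1 f.
  by move=> grey1 /agrees_compatible; apply: maxf.
have contrast_ge := contrast_le_lower_bound Te (maxh f' grey' agr') ge'.
have agrf : agrees Vc h f by apply/agrees_compatible.
apply: (card_half_set Te proper_c greyf agrf maxh contrast_ge _ Vc1 D1).
by rewrite Vc3.
Qed.
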